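(* Let $1\le p<\infty$ and let $\mu$ be a Radon measure on $\mathbb{R}$ satisfying both (i) whenever $f,g$ are extended real-valued Borel functions on $\mathbb{R}$ with $f=g$ $\mu$-a.e., then $T_t(f)=T_t(g)$ $\mu$-a.e. for all $t\in\mathbb{R}$; and (ii) whenever $f$ is a Borel function on $\mathbb{R}$ with $\int_{\mathbb{R}}|f(x)|^p\,d\mu(x)<\infty$, then $\int_{\mathbb{R}}|T_t(f)(x)|^p\,d\mu(x)<\infty$ for all $t\in\mathbb{R}$. Let $\mathcal{N}=[a,b]$ with $a,b\in\mathbb{R}$. Then there is a constant $C_p$ such that $$\|T_t(f)\|_p\le C_p\|f\|_p\quad\text{for all } t\in\mathcal{N},\ f\in L^p(\mu).$$
   Context: A Radon measure on $\mathbb{R}$ is a positive Borel measure $\mu$ on $\mathbb{R}$ with $\mu([-n,n])<\infty$ for all $n\in\mathbb{N}$. For an extended real-valued function $f$ on $\mathbb{R}$ and $t\in\mathbb{R}$, $T_t(f)(x)=f(x-t)$. Under (i) and (ii) the $T_t$ act on $L^p(\mu)$ as a group of linear operators on equivalence classes. $\|\cdot\|_p$ is the norm of $L^p(\mu)$. *)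

(* Defs.v *)
From HB Require Import structures.
From mathcomp Require Import all_boot all_order all_algebra.
From mathcomp Require Import all_classical all_reals all_analysis.
From mathcomp Require Import measurable_realfun.

Set Implicit Arguments.
Unset Strict Implicit.
Unset Printing Implicit Defensive.

Import Order.TTheory GRing.Theory Num.Theory.
Import numFieldNormedType.Exports.

Local Open Scope classical_set_scope.
Local Open Scope ring_scope.

(* [measurableTypeR R] is [R] with its Borel sigma-algebra, and [\bar R] carries
   its Borel sigma-algebra: [mu] below is a Borel measure and [measurable_fun]
   means Borel measurable. *)
Definition radon (R : realType)
    (mu : {measure set (measurableTypeR R) -> \bar R}) : Prop :=
  forall n : nat, (mu `[(- n%:R)%R, n%:R%R]%classic < +oo)%E.

Definition translate (R : realType) (t : R) (f : R -> \bar R) : R -> \bar R :=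
  fun x => f (x - t).

Definition translate_ae (R : realType)
    (mu : {measure set (measurableTypeR R) -> \bar R}) : Prop :=
  forall f g : R -> \bar R,
    measurable_fun [set: measurableTypeR R] f ->
    measurable_fun [set: measurableTypeR R] g ->
    {ae mu, forall x : R, f x = g x} ->
    forall t : R, {ae mu, forall x : R, translate t f x = translate t g x}.

(* The extended real-valued Borel representatives of the classes in L^p(mu)
   (the L^p spaces of the library only have real-valued representatives). *)
Definition Lp_fun (R : realType)
    (mu : {measure set (measurableTypeR R) -> \bar R}) (p : R)
    (f : R -> \bar R) : Prop :=
  measurable_fun [set: measurableTypeR R] f /\
  (\int[mu]_x (`|f x| `^ p) < +oo)%E.

Definition translate_Lp (R : realType)
    (mu : {measure set (measurableTypeR R) -> \bar R}) (p : R) : Prop :=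
  forall f : R -> \bar R, Lp_fun mu p f ->
    forall t : R, (\int[mu]_x (`|translate t f x| `^ p) < +oo)%E.

(* Main.v *)
Require Import Defs.
From HB Require Import structures.
From mathcomp Require Import all_boot all_order all_algebra.
From mathcomp Require Import all_classical all_reals all_analysis.
From mathcomp Require Import measurable_realfun lra.

Set Implicit Arguments.
Unset Strict Implicit.
Unset Printing Implicit Defensive.

Import Order.TTheory GRing.Theory Num.Theory.
Import numFieldNormedType.Exports.

Local Open Scope classical_set_scope.
Local Open Scope ring_scope.

(** Let [tau_t] be the map [x |-> x - t].  Since the integral of
    [|translate t f|^p] against [mu] is the integral of [|f|^p] against the
    image measure [tau_t mu], the operator norm of [translate t] on [L^p(mu)]
    is at most [K^(1/p)] as soon as [tau_t mu <= K mu] as measures.  The claim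
    is thus a bound on the best such constant [K(t)], uniform for [t] in a
    compact interval.

    Each [K(t)] is finite: as translations preserve [p]-integrability, every
    nonnegative [mu]-integrable function is [tau_t mu]-integrable, and if no
    constant worked, a weighted sum of indicators of sets that [tau_t mu]
    inflates more and more would contradict this
    ([bounded_of_integrable_inclusion]).

    For fixed [K], the set of the [t] with [tau_t mu <= K mu] is closed
    ([closed_translation_bounded]): a Radon measure is determined from outside
    by half-open intervals, so that the inequality only has to be tested on
    these, and there it passes to the limit because [mu] of an interval is
    semicontinuous in its endpoints.  The line is the union of these closed
    sets over the integers [K], so by Baire's theorem one of them contains an
    interval ([translation_bounded_interval]).

    Finally [K(s + t) <= K(s) K(t)], which carries the bound from that interval
    to a neighbourhood of [0], and from there, in finitely many small steps, to
    any compact interval ([translation_bounded_segment]). *)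

Lemma ge1_nneseries_pinfty (R : realType) (u : nat -> \bar R) :
  (forall n, 1 <= u n)%E -> (\sum_(n <oo) u n = +oo)%E.
Proof.
move=> u1; apply: eq_infty => r.
have u0 n : (0 <= u n)%E by apply: le_trans (u1 n); rewrite lee_fin.
pose N := (Num.truncn `|r|).+1.
apply: (@le_trans _ _ (\sum_(0 <= i < N) u i)%E); last exact: nneseries_lim_ge.
apply: (@le_trans _ _ (\sum_(0 <= i < N) 1%:E)%E); last exact: lee_sum.
rewrite sumEFin lee_fin sumr_const_nat subn0.
by apply: le_trans (ler_norm r) _; exact/ltW/truncnS_gt.
Qed.

(** A gliding hump.  If sets [E n] with [nu (E n) > 2 ^ n.+1 * mu (E n)] exist,
    they can be weighted by [c n] so that the series of the [c n * \1_(E n)]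
    has [mu]-integral at most [1], while each term has [nu]-integral at
    least [1]. *)
Lemma bounded_of_integrable_inclusion d (T : measurableType d) (R : realType)
    (mu nu : {measure set T -> \bar R}) :
  (forall g : T -> \bar R, measurable_fun [set: T] g ->
     (forall x, 0 <= g x)%E ->
     (\int[mu]_x g x < +oo)%E -> (\int[nu]_x g x < +oo)%E) ->
  exists n : nat, forall E, measurable E -> (nu E <= n%:R%:E * mu E)%E.
Proof.
move=> h; apply: contrapT => /forallNP nb.
have {nb} /choice[E EP] n : exists E, measurable E /\
    ((2 ^ n.+1)%:R%:E * mu E < nu E)%E.
  have /existsNP[E /not_implyP[mE /negP]] := nb (2 ^ n.+1)%N.
  by rewrite -ltNge; exists E.
have mE n := (EP n).1.
have /choice[c cP] n : exists c : \bar R,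
    [/\ 0 <= c, c * mu (E n) <= (1 / (2 ^ n.+1)%:R)%:E & 1 <= c * nu (E n)]%E.
  have [_] := EP n.
  have k0 : 0 < (2 ^ n.+1)%:R :> R by rewrite ltr0n expn_gt0.
  have [-> | muN0] := eqVneq (mu (E n)) 0%E.
    (* An infinite weight costs nothing on a [mu]-null set. *)
    rewrite mule0 => nu0; exists +oo%E; split => //.
      by rewrite mule0 lee_fin divr_ge0// ltW.
    by rewrite gt0_mulye// leey.
  have mu0 : (0 < mu (E n))%E by rewrite lt0e muN0 measure_ge0.
  case: (mu (E n)) mu0 => [r|_|//]; last by rewrite gt0_muley// ltNge leey.
  rewrite lte_fin => r0 lt; exists ((2 ^ n.+1)%:R * r)^-1%:E; split.
  - by rewrite lee_fin invr_ge0 mulr_ge0// ltW.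
  - by rewrite -EFinM lee_fin invfM -mulrA mulVf ?gt_eqF// mulr1 div1r.
  - by rewrite lee_pdivlMl ?mulr_gt0// mule1 EFinM ltW.
pose f n x := (c n * (\1_(E n) x)%:E)%E.
have f0 n x : (0 <= f n x)%E.
  by have [c0 _ _] := cP n; rewrite mule_ge0// lee_fin.
have mind n : measurable_fun [set: T] (fun x => (\1_(E n) x)%:E : \bar R).
  by apply/measurable_EFinP; exact: measurable_indic.
have mf n : measurable_fun [set: T] (f n).
  by apply: emeasurable_funM => //; exact: mind.
have intf (m : {measure set T -> \bar R}) n :
    (\int[m]_x f n x = c n * m (E n))%E.
  rewrite ge0_integralZl//; last by case: (cP n).
  by rewrite integral_indic// setIT.
have := h (fun x => \sum_(n <oo) f n x)%E.
rewrite !integral_nneseries//.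
under eq_eseriesr do rewrite intf.
under [X in _ -> _ -> _ -> (X < _)%E]eq_eseriesr do rewrite intf.
rewrite [X in _ -> _ -> _ -> (X < _)%E]ge1_nneseries_pinfty; last first.
  by move=> n; case: (cP n).
rewrite ltxx => absurd; apply: notF; apply: absurd.
- by apply: ge0_emeasurable_sum.
- by move=> x; apply: nneseries_ge0.
- apply: (@le_lt_trans _ _ 1%:E); last exact: ltry.
  apply: le_trans (epsilon_trick0 xpredT ler01).
  apply: lee_nneseries => n _; last by case: (cP n).
  by case: (cP n) => c0 _ _; rewrite mule_ge0.
Qed.

Section ocitv_trace.
Context {R : realType} (mu : {measure set (measurableTypeR R) -> \bar R}).

(** The measure [mu] seen as a content on the semiring of half-open intervals:
    for [radon mu], Caratheodory's extension of it gives back [mu], which is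
    where the covering formula for [mu A] comes from. *)
Definition ocitv_trace : set (ocitv_type R) -> \bar R := mu.

Let ocitv_measurable (A : set (ocitv_type R)) :
  measurable A -> measurable (A : set (measurableTypeR R)).
Proof. by move=> mA; exact: sub_sigma_algebra. Qed.

Let ocitv_trace0 : ocitv_trace set0 = 0%E.
Proof. exact: measure0. Qed.

Let ocitv_trace_ge0 A : (0 <= ocitv_trace A)%E.
Proof. exact: measure_ge0. Qed.

Let ocitv_trace_semi_sigma_additive : semi_sigma_additive ocitv_trace.
Proof.
move=> F mF tF mU; have mF' i : measurable (F i : set (measurableTypeR R)).
  exact: ocitv_measurable (mF i).
exact: (@measure_semi_sigma_additive _ _ _ mu F mF' tF (ocitv_measurable mU)).
Qed.

HB.instance Definition _ := isMeasure.Build _ (ocitv_type R) R ocitv_trace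
  ocitv_trace0 ocitv_trace_ge0 ocitv_trace_semi_sigma_additive.

Lemma radon_ocitv x y : radon mu -> (mu `]x, y]%classic < +oo)%E.
Proof.
move=> rmu.
pose n := (Num.truncn (`|x| + `|y|)).+1.
apply: le_lt_trans (rmu n); apply: le_measure; rewrite ?inE.
- exact: measurable_itv.
- exact: measurable_itv.
- have ltn : `|x| + `|y| < n%:R by exact: truncnS_gt.
  move=> z /=; rewrite !in_itv /= => /andP[xz zy].
  have := ler_norm y; have := lerNnormlW (lexx `|x|).
  have := normr_ge0 x; have := normr_ge0 y; lra.
Qed.

(** Outer regularity of a Radon measure on the line, with countable families of
    half-open intervals in the role of the open supersets: it is the uniqueness
    of the extension of a sigma-finite content. *)
Lemma radon_ocitv_extension A : radon mu -> measurable A ->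
  mu A = (ocitv_trace^*)%mu A.
Proof.
move=> rmu mA.
rewrite -(@measure_extension_unique _ _ _ ocitv_trace _ mu)//.
exists (fun n => `](- n%:R), n%:R]%classic).
  apply/esym; rewrite -subTset => x _.
  exists (Num.truncn `|x|).+1 => //=; rewrite in_itv /=.
  have := truncnS_gt `|x|; rewrite ltr_norml => /andP[-> /ltW]; done.
by move=> n; split; [exact: is_ocitv|exact: radon_ocitv].
Qed.

End ocitv_trace.

(** Covering [E] by half-open intervals, [nu E] is at most [K] times the total
    [mu]-mass of the cover, and the infimum of these masses is [mu E]. *)
Lemma le_scaled_measure_of_ocitv (R : realType)
    (mu nu : {measure set (measurableTypeR R) -> \bar R}) (K : R) :
  radon mu -> 0 < K ->
  (forall x y : R, nu `]x, y]%classic <= K%:E * mu `]x, y]%classic)%E ->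
  forall E, measurable E -> (nu E <= K%:E * mu E)%E.
Proof.
move=> rmu K0 numu E mE.
rewrite -lee_pdivrMl// (radon_ocitv_extension rmu)//.
apply: le_ereal_inf_tmp => _ [F [mF EF] <-].
rewrite lee_pdivrMl// -nneseriesZl//.
have mF' n : measurable (F n : set (measurableTypeR R)).
  by apply: sub_sigma_algebra; exact: mF.
apply: le_trans (measure_sigma_subadditive nu mF' mE EF) _.
apply: lee_nneseries => // n _.
by have [[x y] _ <-] := mF n; exact: numu.
Qed.

Definition translation (R : realType) (t : R) :
    measurableTypeR R -> measurableTypeR R :=
  fun x => x - t.

Lemma measurable_translation (R : realType) (t : R) :
  measurable_fun [set: measurableTypeR R] (translation t).
Proof.
by apply: measurable_funB; [exact: measurable_id|exact: measurable_cst].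
Qed.

HB.instance Definition _ (R : realType) (t : R) :=
  isMeasurableFun.Build _ _ _ _ (translation t) (measurable_translation t).

(** By change of variables, this says that translating functions by [t]
    multiplies their [L^1(mu)]-norm by at most [K]. *)
Definition translation_bounded (R : realType)
    (mu : {measure set (measurableTypeR R) -> \bar R}) (K t : R) : Prop :=
  forall E, measurable E -> (pushforward mu (translation t) E <= K%:E * mu E)%E.

Lemma translation_boundedD (R : realType)
    (mu : {measure set (measurableTypeR R) -> \bar R}) (K L s t : R) : 0 <= K ->
  translation_bounded mu K s -> translation_bounded mu L t ->
  translation_bounded mu (K * L) (s + t).
Proof.
move=> K0 bs bt E mE.
have -> : pushforward mu (translation (s + t)) E =
    pushforward mu (translation s) (translation t @^-1` E).
  congr (mu _); apply/seteqP; split => x;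
    by rewrite /translation /= opprD addrA.
have mtE : measurable (translation t @^-1` E).
  by rewrite -[X in measurable X]setTI; exact: measurable_translation.
apply: le_trans (bs _ mtE) _.
by rewrite EFinM -muleA lee_wpmul2l ?lee_fin//; exact: bt.
Qed.

(** If [s] is admissible and within [e] of [t], translating by [t] instead of
    [s] moves endpoints by less than [e]; hence the image of [mu] under the
    translation by [t] gives [[x + e, y]] at most [K] times the [mu]-mass of
    []x, y + e]].  As [e] tends to [0], the first interval increases and the
    second decreases to []x, y]]; the latter has finite mass, so both measures
    converge. *)
Lemma closed_translation_bounded (R : realType)
    (mu : {measure set (measurableTypeR R) -> \bar R}) (K : R) :
  radon mu -> 0 < K -> closed [set t : R | translation_bounded mu K t].
Proof.
move=> rmu K0 t clt.
apply: le_scaled_measure_of_ocitv => // x y.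
set nu := pushforward mu (translation t).
pose A n := `[x + n.+1%:R^-1, y]%classic : set (measurableTypeR R).
pose B n := `]x, y + n.+1%:R^-1]%classic : set (measurableTypeR R).
have invS_le n m : (n <= m)%N -> m.+1%:R^-1 <= n.+1%:R^-1 :> R.
  by move=> nm; rewrite lef_pV2 ?posrE// ler_nat.
have UA : `]x, y]%classic = \bigcup_n A n by exact: itv_open_bnd_bigcup.
have IB : `]x, y]%classic = \bigcap_n B n.
  apply/seteqP; split=> z /=.
    rewrite in_itv/= => /andP[xz zy] n _ /=.
    by rewrite /B /= in_itv/= xz/= (le_trans zy)// lerDl.
  move=> zB; have := zB 0%N I; rewrite /B /= !in_itv/= => /andP[-> _] /=.
  rewrite leNgt; apply/negP => /ltr_add_invr[n yz].
  by have := zB n I; rewrite /B /= in_itv/= leNgt yz andbF.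
have mA n : measurable (A n) by exact: measurable_itv.
have mB n : measurable (B n) by exact: measurable_itv.
have cvgA : (nu \o A) n @[n --> \oo] --> nu `]x, y]%classic.
  rewrite UA; apply: nondecreasing_cvg_mu => //.
    by rewrite -UA; exact: measurable_itv.
  move=> n m nm; apply/subsetPset => z /=; rewrite /A /= !in_itv/=.
  by move=> /andP[+ ->]; rewrite andbT; apply: le_trans; rewrite lerD2l invS_le.
have cvgB : (mu \o B) n @[n --> \oo] --> mu `]x, y]%classic.
  rewrite IB; apply: nonincreasing_cvg_mu => //.
  - exact: radon_ocitv.
  - by rewrite -IB; exact: measurable_itv.
  - move=> n m nm; apply/subsetPset => z /=; rewrite /B /= !in_itv/=.
    by move=> /andP[-> /= zy]; apply: le_trans zy _; rewrite lerD2l invS_le.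
have cvgKB := cvgeZl (isT : K%:E \is a fin_num) cvgB.
apply: (lee_cvg_to cvgA cvgKB); apply: nearW => n /=.
have e0 : 0 < n.+1%:R^-1 :> R by [].
have [s [bs ts]] := clt _ (nbhsx_ballx t _ e0).
apply: le_trans (bs _ (mB n)).
rewrite /nu /pushforward /=; apply: le_measure; rewrite ?inE//.
- by rewrite -[X in measurable X]setTI; exact: measurable_translation.
- by rewrite -[X in measurable X]setTI; exact: measurable_translation.
- have sub_lt (e w u v : R) : x + e <= w - u -> v - e < u -> x < w - v by lra.
  have sub_le (e w u v : R) : w - u <= y -> u < v + e -> w - v <= y + e by lra.
  move=> z; rewrite /A /B /translation /= !in_itv/= => /andP[xz zy].
  move: ts; rewrite /ball /= ltr_distl => /andP[ts1 ts2].
  by rewrite (sub_lt _ _ _ _ xz ts1) (sub_le _ _ _ _ zy ts2).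
Qed.

Section translation_bounds.
Context {R : realType} (mu : {measure set (measurableTypeR R) -> \bar R}).

Lemma integral_translate (g : R -> \bar R) (t : R) :
  measurable_fun [set: measurableTypeR R] g -> (forall x, 0 <= g x)%E ->
  (\int[mu]_x translate t g x = \int[pushforward mu (translation t)]_x g x)%E.
Proof.
move=> mg g0.
by rewrite (ge0_integral_pushforward (measurable_translation t)).
Qed.

(** A nonnegative integrable [g] is the [p]-th power of [g `^ p^-1], so that
    stability of [p]-integrability under translation is stability of
    integrability for nonnegative functions. *)
Lemma exists_translation_bound (p t : R) : 0 < p -> translate_Lp mu p ->
  exists n : nat, translation_bounded mu n%:R t.
Proof.
move=> p_gt0 Lp_stable; apply: bounded_of_integrable_inclusion => g mg g0 intg.
have pN0 : p != 0 by rewrite gt_eqF.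
have gE x : (`|g x `^ p^-1| `^ p = g x)%E.
  by rewrite gee0_abs ?poweR_ge0// -poweRrM mulVf// poweRe1.
have Lpg : Lp_fun mu p (fun x => g x `^ p^-1)%E.
  split; last by under eq_integral do rewrite gE.
  exact: (measurableT_comp (measurable_poweR p^-1)).
have := Lp_stable _ Lpg t.
rewrite -integral_translate//.
by under eq_integral do rewrite /translate gE.
Qed.

(** Baire's theorem: countably many closed sets of admissible translations
    cover the line, so one of them has an interior point. *)
Lemma translation_bounded_interval :
  radon mu -> (forall t, exists n : nat, translation_bounded mu n%:R t) ->
  exists c d M : R,
  [/\ 0 < d, 0 < M & forall h, `|h| < d -> translation_bounded mu M (c + h)].
Proof.
move=> rmu bt; pose D n := [set t : R | translation_bounded mu n.+1%:R t].
have clD n : closed (D n) by apply: closed_translation_bounded.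
have : ~ (forall n, open (~` D n) /\ dense (~` D n)).
  move=> /Baire /(_ setT); case => //.
  - by exists 0.
  - exact: openT.
  - move=> t [_ tD]; have [n bn] := bt t.
    apply: (tD n) => // E mE; apply: le_trans (bn _ mE) _.
    by rewrite lee_wpmul2r// lee_fin ler_nat.
move=> /existsNP[n /not_andP[]]; first by rewrite openC; move/(_ (clD n)).
move=> /existsNP[U /not_implyP[[c Uc] /not_implyP[oU UD]]].
have /nbhs_ballP[d /= d0 cdU] : nbhs c U by exact: open_nbhs_nbhs.
exists c, d, n.+1%:R; split => // h hd.
apply: contrapT => nb; apply: UD; exists (c + h); split => //.
by apply: cdU; rewrite /ball /= opprD addrA subrr sub0r normrN.
Qed.

Lemma translation_bounded_iter (M h : R) (n : nat) : 0 <= M ->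
  translation_bounded mu M h -> translation_bounded mu (M ^+ n) (n%:R * h).
Proof.
move=> M0 bh; elim: n => [|n IH].
  rewrite mul0r expr0 => E _; rewrite mul1e /pushforward.
  rewrite (_ : translation 0 @^-1` E = E)//.
  by apply/seteqP; split => x; rewrite /translation/= subr0.
by rewrite exprS -natr1 mulrDl mul1r addrC; exact: translation_boundedD.
Qed.

(** With [M] a bound valid within [d] of [c], a step [h] shorter than [d] is the
    translation by [- c] followed by the one by [c + h], and [t] is reached from
    [a] in [n] equal such steps. *)
Lemma translation_bounded_segment (a b : R) :
  radon mu -> (forall t, exists n : nat, translation_bounded mu n%:R t) ->
  exists2 K : R, 0 <= K &
  forall t, t \in `[a, b] -> translation_bounded mu K t.
Proof.
move=> rmu bt.
have [c [d [M [d0 M0 bM]]]] := translation_bounded_interval rmu bt.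
have [k bk] := bt (- c).
have [l bl] := bt a.
(* This many steps make each one shorter than [d]. *)
pose n := (Num.truncn ((b - a) / d)).+1.
have n0 : 0 < n%:R :> R by rewrite ltr0n.
exists ((k%:R * M) ^+ n * l%:R).
  by rewrite mulr_ge0// exprn_ge0// mulr_ge0// ltW.
move=> t; rewrite in_itv /= => /andP[at_ tb].
have -> : t = n%:R * (- c + (c + (t - a) / n%:R)) + a.
  by rewrite addKr mulrC divfK ?gt_eqF// subrK.
apply: translation_boundedD => //; first by rewrite exprn_ge0// mulr_ge0// ltW.
apply: translation_bounded_iter; first by rewrite mulr_ge0// ltW.
apply: translation_boundedD => //; apply: bM.
rewrite ger0_norm; last by rewrite divr_ge0 ?subr_ge0.
rewrite ltr_pdivrMr// mulrC.
apply: (@le_lt_trans _ _ (b - a)); first by rewrite lerB.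
by rewrite -ltr_pdivrMr//; exact: truncnS_gt.
Qed.

Lemma Lnorm_translate_le (p K t : R) (f : R -> \bar R) : 0 < p -> 0 <= K ->
  translation_bounded mu K t -> measurable_fun [set: measurableTypeR R] f ->
  ('N[mu]_(p%:E) [translate t f] <= (K `^ p^-1)%:E * 'N[mu]_(p%:E) [f])%E.
Proof.
move=> p_gt0 K0 bt mf.
rewrite unlock -poweR_EFin -poweRM ?integral_ge0//; last first.
  by move=> x _; exact: poweR_ge0.
have mg : measurable_fun [set: measurableTypeR R] (fun x => `|f x| `^ p)%E.
  apply: (measurableT_comp (measurable_poweR p)).
  exact: measurableT_comp.
have i0 (m : {measure set (measurableTypeR R) -> \bar R}) g :
    (0 <= \int[m]_x (`|g x| `^ p))%E.
  by apply: integral_ge0 => x _; exact: poweR_ge0.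
apply: gt0_ler_poweR; rewrite ?in_itv /= ?leey ?andbT ?mule_ge0//.
  by rewrite invr_ge0 ltW.
rewrite (integral_translate t mg) => [|x]; last exact: poweR_ge0.
have -> : (K%:E * \int[mu]_x (`|f x| `^ p) =
    \int[mscale (NngNum K0) mu]_x (`|f x| `^ p))%E.
  by rewrite ge0_integral_mscale// => x _; exact: poweR_ge0.
apply: ge0_le_measure_integral => // x; exact: poweR_ge0.
Qed.

End translation_bounds.

Theorem corollary2 (R : realType) (p : R) (hp : 1 <= p)
    (mu : {measure set (measurableTypeR R) -> \bar R})
    (hradon : radon mu)
    (hi : translate_ae mu)
    (hii : translate_Lp mu p)
    (a b : R) :
  exists C : R, forall t : R, t \in `[a, b] ->
    forall f : R -> \bar R, Lp_fun mu p f ->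
      ('N[mu]_(p%:E) [translate t f] <= C%:E * 'N[mu]_(p%:E) [f])%E.
Proof.
have p0 : 0 < p by apply: lt_le_trans hp.
have bt t := exists_translation_bound t p0 hii.
have [K K0 bK] := translation_bounded_segment a b hradon bt.
exists (K `^ p^-1) => t /bK Kt f [mf _].
exact: Lnorm_translate_le.
Qed.
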